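(* Let $k$ be an algebraically closed field of characteristic zero, $S=k[x_1,\dots,x_n]$, and let $P\subseteq S$ be a prime ideal. Let $k(P)$ be the field of fractions of $S/P$, and suppose that $A$ is a matrix with entries in $k(P)$. Then there exists a nonempty set $U\subseteq V(P)$ such that for every $u\in U$ the specialization $A_u$ is defined and $M(A)=M(A_u)$.
   Context: $V(P)=\{z\in k^n : f(z)=0 \text{ for all } f\in P\}$. For $f\in S$, $[f]$ denotes its coset in $S/P$; every element of $k(P)$ has the form $[f]/[g]$ with $f,g\in S$ and $g\notin P$. For a matrix $B$ with $m$ columns over a field, $M(B)$ is the linear matroid with ground set $\{1,\dots,m\}$ whose independent sets are the $I\subseteq\{1,\dots,m\}$ such that the columns of $B$ indexed by $I$ are linearly independent (over the field containing the entries of $B$). Specialization: for $z\in V(P)$, $A_z$ is the matrix over $k$ of the same size as $A$ obtained by evaluating coset representatives of the entries of $A$ at $z$: an entry $[f]/[g]$, written with $g(z)\neq 0$, is replaced by $f(z)/g(z)\in k$ (this value does not depend on the choice of such $f,g$). $A_z$ is defined when every entry of $A$ can be written as $[f]/[g]$ with $g(z)\ne 0$. *)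

(* Defs.v *)
From HB Require Import structures.
From mathcomp Require Import boolp classical_sets.
From mathcomp Require Import all_boot all_order all_algebra.
From mathcomp Require Import mpoly.

Set Implicit Arguments.
Unset Strict Implicit.
Unset Printing Implicit Defensive.

Import GRing.Theory.
Local Open Scope ring_scope.
Local Open Scope quotient_scope.

Section Matroid.
Variable T : finType.

Definition matroid_axioms (F : {set {set T}}) : bool :=
  [&& set0 \in F,
      [forall I in F, forall J : {set T}, (J \subset I) ==> (J \in F)]
    & [forall I in F, forall J in F, (#|I| < #|J|)%N ==>
         [exists x in J :\: I, x |: I \in F]]].

Record matroid := Matroid {
  indep :> {set {set T}};
  indepP : matroid_axioms indep
}.

HB.instance Definition _ := [isSub for indep].

End Matroid.

Section LinearMatroid.
Variables (F : fieldType) (r m : nat) (B : 'M[F]_(r, m)).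

(* [free] is about families: equal columns at two indices of [I] are
   linearly dependent. *)
Definition col_indep (I : {set 'I_m}) : bool :=
  free [seq col j B | j <- enum I].

Definition col_indep_sets : {set {set 'I_m}} := [set I | col_indep I].

Lemma col_indep_axioms : matroid_axioms col_indep_sets.
Proof.
have dimI (I : {set 'I_m}) : col_indep I ->
    \dim <<[seq col j B | j <- enum I]>> = #|I|.
  by move=> /eqP; rewrite size_map -cardE.
apply/and3P; split.
- by rewrite inE /col_indep enum_set0 nil_free.
- apply/forall_inP => I; rewrite inE => fI.
  apply/forall_inP => J sJI; rewrite inE /col_indep.
  have pIJ : perm_eq (enum I) (enum J ++ enum (I :\: J)).
    apply: uniq_perm; rewrite ?cat_uniq ?enum_uniq //= ?andbT.
      apply/hasPn => x; rewrite !mem_enum inE => /andP[xJ _]; exact: xJ.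
    move=> x; rewrite mem_cat !mem_enum inE.
    by case: (boolP (x \in J)) => // /(subsetP sJI) ->.
  move: fI; rewrite /col_indep (perm_free (perm_map _ pIJ)) map_cat.
  exact: catl_free.
- apply/forall_inP => I; rewrite inE => fI.
  apply/forall_inP => J; rewrite inE => fJ.
  apply/implyP => ltIJ; apply: contraLR ltIJ => /exists_inPn nx.
  rewrite -leqNgt -(dimI _ fI) -(dimI _ fJ); apply: dimvS.
  apply/span_subvP => _ /mapP[x xJ ->]; rewrite mem_enum in xJ.
  have [xI|xI] := boolP (x \in I).
    by apply/memv_span/map_f; rewrite mem_enum.
  have := nx x; rewrite inE xI xJ => /(_ isT).
  have pI : perm_eq (enum (x |: I)) (x :: enum I).
    apply: uniq_perm; rewrite /= ?enum_uniq ?mem_enum ?xI //.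
    by move=> y; rewrite !(inE, mem_enum).
  rewrite inE /col_indep (perm_free (perm_map _ pI)) /= free_cons.
  by rewrite negb_and negbK (_ : free _ = true) // orbF.
Qed.

Definition linear_matroid : matroid 'I_m := Matroid col_indep_axioms.

End LinearMatroid.

(* [prime_idealr R] is the type of proper prime ideals of [R], given as boolean
   predicates; classically every prime ideal is of this form.
   The library provides [{ideal_quot P}] as a [comNzRingType] only; its integral
   domain structure needs a (classical) decision of invertibility. *)
Definition domain_quot (R : comNzRingType) (P : prime_idealr R) : Type :=
  {ideal_quot P}.

Section DomainQuot.
Variables (R : comNzRingType) (P : prime_idealr R).
Local Notation Q := (domain_quot P).

HB.instance Definition _ := GRing.ComNzRing.copy Q {ideal_quot P}.

Definition dq_unit : {pred Q} := [pred x : Q | `[< exists y : Q, y * x = 1 >]].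
Definition dq_inv (x : Q) : Q := xget x [set y : Q | y * x = 1]%classic.

Lemma dq_mulVx : {in dq_unit, left_inverse 1 dq_inv *%R}.
Proof. by move=> x /asboolP[y yx]; rewrite /dq_inv; case: xgetP => // /(_ y). Qed.

Lemma dq_unitPl (x y : Q) : y * x = 1 -> dq_unit x.
Proof. by move=> yx; apply/asboolP; exists y. Qed.

Lemma dq_inv_out : {in [predC dq_unit], dq_inv =1 id}.
Proof.
move=> x; rewrite inE /= => /negP nx; rewrite /dq_inv.
by case: xgetP => // y _ yx; case: nx; apply: dq_unitPl yx.
Qed.

HB.instance Definition _ := GRing.ComNzRing_hasMulInverse.Build Q
  dq_mulVx dq_unitPl dq_inv_out.
HB.instance Definition _ := GRing.ComUnitRing_isIntegral.Build Q
  (@Quotient.rquot_IdomainAxiom R P).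

Definition coset_mod (f : R) : Q := \pi_({ideal_quot P}) f.

Fact coset_mod_zmod_morphism : zmod_morphism coset_mod.
Proof. exact: (rmorphB (\pi_({ideal_quot P}))). Qed.

Fact coset_mod_monoid_morphism : monoid_morphism coset_mod.
Proof.
by split; [exact: (rmorph1 (\pi_({ideal_quot P})))
         | exact: (rmorphM (\pi_({ideal_quot P})))].
Qed.

HB.instance Definition _ := GRing.isZmodMorphism.Build R Q coset_mod
  coset_mod_zmod_morphism.
HB.instance Definition _ := GRing.isMonoidMorphism.Build R Q coset_mod
  coset_mod_monoid_morphism.

Lemma coset_mod_eq0 f : (coset_mod f == 0) = (f \in P).
Proof.
by rewrite -(rmorph0 coset_mod) /coset_mod -Quotient.idealrBE subr0.
Qed.

End DomainQuot.

Section Specialization.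
Variables (k : closedFieldType) (n : nat) (P : prime_idealr {mpoly k[n]}).

Definition zero_locus : set ('I_n -> k) :=
  [set z | forall f, f \in P -> f.@[z] = 0]%classic.

Definition residue_field : fieldType := {fraction domain_quot P}.

(* The element [f]/[g] of k(P); meaningful for [g \notin P]. *)
Definition coset_frac (f g : {mpoly k[n]}) : residue_field :=
  FracField.tofrac (coset_mod P f) / FracField.tofrac (coset_mod P g).

Definition specializes_to (z : 'I_n -> k) (a : residue_field) (c : k) : Prop :=
  exists f g : {mpoly k[n]},
    [/\ g \notin P, a = coset_frac f g, g.@[z] != 0 & c = f.@[z] / g.@[z]].

Lemma specializes_to_fun (z : 'I_n -> k) a c d : zero_locus z ->
  specializes_to z a c -> specializes_to z a d -> c = d.
Proof.
move=> Vz [f [g [gP -> gz ->]]] [f' [g' [g'P e g'z ->]]].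
have nz h : h \notin P -> FracField.tofrac (coset_mod P h) != 0.
  by move=> hP; rewrite tofrac_eq0 coset_mod_eq0.
move/eqP: e; rewrite /coset_frac eqr_div ?nz // -!rmorphM -subr_eq0 -rmorphB.
rewrite tofrac_eq0 -rmorphB coset_mod_eq0 => /Vz.
rewrite mevalB !mevalM => /eqP; rewrite subr_eq0 => /eqP e.
by apply/eqP; rewrite eqr_div // e.
Qed.

(* A junk value when [a] is not defined at [z]. *)
Definition specialize_elt (z : 'I_n -> k) (a : residue_field) : k :=
  xget 0 [set c | specializes_to z a c]%classic.

Lemma specialize_eltE (z : 'I_n -> k) a c : zero_locus z ->
  specializes_to z a c -> specialize_elt z a = c.
Proof.
move=> Vz zac; rewrite /specialize_elt; case: xgetP => [d _ zad|/(_ c)//].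
exact: specializes_to_fun zad zac.
Qed.

Variables (r m : nat) (A : 'M[residue_field]_(r, m)).

Definition specialization_defined (z : 'I_n -> k) : Prop :=
  forall i j, exists f g : {mpoly k[n]},
    [/\ g \notin P, A i j = coset_frac f g & g.@[z] != 0].

Definition specialization (z : 'I_n -> k) : 'M[k]_(r, m) :=
  map_mx (specialize_elt z) A.

End Specialization.

(* Main.v *)
(** The set U can be a single point. Write A = B / d with B a matrix over S and
    d outside P. A set of columns is independent iff some maximal minor on it is
    nonzero, so it suffices to find z in V(P) at which d and the finitely many
    minors of B lying outside P do not vanish: the minors in P vanish at z
    anyway. Such a z exists for every b outside P by induction on n, extending
    points one variable at a time: for a polynomial ring T[X] mapping to a field
    with kernel p, and b not in p, there is a in T outside p such that every
    point of V(p /\ T) at which a does not vanish extends to a point of V(p) at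
    which b does not vanish. *)
Require Import Defs.
From HB Require Import structures.
From mathcomp Require Import boolp classical_sets.
From mathcomp Require Import all_boot all_order all_algebra.
From mathcomp Require Import mpoly.

Set Implicit Arguments.
Unset Strict Implicit.
Unset Printing Implicit Defensive.

Import GRing.Theory.
Local Open Scope ring_scope.

(** * Extending a point by one variable *)

(** Take a lift of an image of least size and truncate it to that size: this drops only coefficients
    killed by [f], so the image is unchanged and the leading coefficient survives. *)
Lemma minimal_lift (T : comNzRingType) (L : fieldType) (f : {rmorphism T -> L})
    (Q : {poly L} -> Prop) (q0 : {poly T}) :
    (forall p, Q p -> p != 0) -> Q (map_poly f q0) ->
  exists q : {poly T}, [/\ Q (map_poly f q), f (lead_coef q) != 0
    & forall p : {poly T}, Q (map_poly f p) -> (size q <= size (map_poly f p))%N].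
Proof.
move=> Qn0 Qq0.
have ex : exists n, `[< exists2 p, Q (map_poly f p) & size (map_poly f p) = n >].
  by exists (size (map_poly f q0)); apply/asboolP; exists q0.
case: (ex_minnP ex) => n /asboolP[p Qp szp] nmin.
have e : map_poly f (take_poly n p) = map_poly f p.
  apply/polyP => i; rewrite !coef_map coef_take_poly; case: ltnP => // le_ni.
  by rewrite -coef_map [RHS]nth_default ?szp // raddf0.
have sz : size (take_poly n p) = n.
  apply/eqP; rewrite eqn_leq size_take_poly -{1}szp -e /=.
  by rewrite (leq_trans (size_poly _ _)).
exists (take_poly n p); rewrite e sz; split=> // [|p' Qp'].
  by rewrite lead_coefE sz -coef_map e -szp -lead_coefE lead_coef_eq0 Qn0.
by apply: nmin; apply/asboolP; exists p'.
Qed.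

Section ExtendPoint.
Variables (T : comNzRingType) (L : fieldType) (k : closedFieldType).
Variable (j : {rmorphism {poly T} -> L}).

Let f : {rmorphism T -> L} := (j \o polyC)%FUN.
Let x : L := j 'X.

Let jE p : j p = (map_poly f p).[x].
Proof.
elim/poly_ind: p => [|p c IH]; first by rewrite !rmorph0 horner0.
by rewrite !rmorphD !rmorphM /= map_polyX map_polyC !hornerE -IH.
Qed.

Let lead_neq0 q : f (lead_coef q) != 0 -> map_poly f q != 0.
Proof.
by move=> lq; rewrite -lead_coef_eq0 lead_coef_map_eq.
Qed.

Let division (p q : {poly T}) : f (lead_coef q) != 0 ->
  exists N h r, [/\ lead_coef q ^+ N *: p = h * q + r
    & (size (map_poly f r) < size q)%N].
Proof.
move=> lq; exists (Pdiv.Ring.rscalp p q), (Pdiv.Ring.rdivp p q),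
  (Pdiv.Ring.rmodp p q).
split; first exact: Pdiv.ComRing.rdivp_eq.
apply: leq_ltn_trans (size_poly _ _) _; rewrite Pdiv.Ring.ltn_rmodp.
by apply: contraNneq lq => ->; rewrite lead_coef0 rmorph0.
Qed.

(* In the algebraic case, [q] lifts a minimal polynomial of [x]; [s] is a
   non-zero constant in the ideal generated by [b] and the kernel of [j]. *)
Let const_multiple (q b : {poly T}) :
    f (lead_coef q) != 0 -> j q = 0 -> j b != 0 ->
    (forall p, j p = 0 -> map_poly f p != 0 -> (size q <= size (map_poly f p))%N) ->
  exists s u, f s != 0 /\ j (s%:P - u * b) = 0.
Proof.
move=> lq jq jb qmin.
(* A polynomial [g] of least degree in this class will turn out to be constant; its constant is
   [s]. *)
pose Q p := p.[x] != 0 /\ exists u, p.[x] = j (u * b).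
have Qn0 p : Q p -> p != 0.
  by move=> [px _]; apply: contraNneq px => ->; rewrite horner0.
have Qb : Q (map_poly f b) by rewrite /Q -jE; split=> //; exists 1; rewrite mul1r.
have [g [[]]] := minimal_lift Qn0 Qb.
rewrite -jE => jg [u ju] lg gmin.
(* Reducing [g] modulo [q] only multiplies its value at [x] by a power of a nonzero constant, so the
   remainder stays in the class. *)
have le_gq : (size g < size q)%N.
  have [N [h [r [e szr]]]] := division g lq.
  apply: leq_ltn_trans szr; apply: gmin.
  have jr : j r = j ((lead_coef q ^+ N)%:P * g).
    by rewrite mul_polyC e rmorphD rmorphM jq mulr0 add0r.
  rewrite /Q -jE jr; split.
    rewrite rmorphM mulf_neq0 // rmorphXn /= rmorphXn /= expf_neq0 //.
  by exists ((lead_coef q ^+ N)%:P * u); rewrite -mulrA rmorphM ju -rmorphM.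
(* Modulo the kernel of [j], the remainder is a multiple of [b]. Minimality of [g] forces [j r = 0],
   and then minimality of [q] forces [r] to map to 0. *)
have [N [h [r [e szr]]]] := division q lg.
have jr : j r = 0.
  apply/eqP/negP => /negP jr.
  suff : (size g <= size (map_poly f r))%N by rewrite leqNgt szr.
  apply: gmin; rewrite /Q -jE; split=> //; exists (- h * u).
  rewrite -mulrA mulNr rmorphN rmorphM -ju -rmorphM.
  by apply/eqP; rewrite -addr_eq0 addrC -rmorphD -e -mul_polyC rmorphM jq mulr0.
have r0 : map_poly f r = 0.
  apply/eqP/negP => /negP rn0.
  by have := leq_trans szr (ltnW (leq_trans le_gq (qmin r jr rn0))); rewrite ltnn.
have fe : f (lead_coef g) ^+ N *: map_poly f q = map_poly f h * map_poly f g.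
  rewrite -rmorphXn -mul_polyC -map_polyC -!rmorphM /= mul_polyC e rmorphD /= r0.
  by rewrite addr0.
have hn0 : map_poly f h != 0.
  apply: contraTneq (lead_neq0 lq) => h0; move/eqP: fe; rewrite h0 mul0r.
  by rewrite scaler_eq0 expf_eq0 (negPf lg) andbF /= => ->.
have jh : j h = 0.
  apply/eqP; have /(congr1 (horner^~ x)) := fe.
  rewrite /= hornerZ hornerM -!jE jq mulr0 => /esym/eqP.
  by rewrite mulf_eq0 (negPf jg) orbF.
(* By [fe] the degrees of [h] and [g] add up to that of [q], while [h] vanishes at [x] and so has at
   least the degree of [q]. *)
have szg : (size g <= 1)%N.
  have := qmin h jh hn0; have /(congr1 (size \o @polyseq _)) := fe.
  rewrite /= size_scale ?expf_neq0 // size_mul // ?lead_neq0 //.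
  rewrite !(size_map_poly_id0 lq) !(size_map_poly_id0 lg) => ->.
  rewrite -[X in (_ <= X)%N]addn0; case: (size g) => [|m]; first by [].
  by rewrite addnS /= leq_add2l.
have gE := size1_polyC szg.
exists g`_0, u; split; first by rewrite gE lead_coefC in lg.
by rewrite -gE rmorphB ju subrr.
Qed.

(** If [x] is transcendental over the image of [T], the kernel of [j] consists of the polynomials
    with all coefficients in the kernel of [f], and [a] can be any coefficient of [b] outside it. If
    [x] is algebraic, [z] is a root of the specialized minimal polynomial, and [a] is the product of
    its leading coefficient and the constant [s]. *)
Lemma extend_point (b : {poly T}) : j b != 0 ->
  exists2 a : T, j a%:P != 0 & forall phi : {rmorphism T -> k},
    (forall t, j t%:P = 0 -> phi t = 0) -> phi a != 0 ->
  exists2 z, (forall p, j p = 0 -> (map_poly phi p).[z] = 0)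
    & (map_poly phi b).[z] != 0.
Proof.
move=> jb.
have [[q1 [jq1 q1n0]]|noq] :=
    pselect (exists q, j q = 0 /\ map_poly f q != 0); last first.
  have fb : map_poly f b != 0.
    by apply: contraNneq jb => fb; rewrite jE fb horner0.
  have [i bi] : exists i, f b`_i != 0.
    by exists (size (map_poly f b)).-1; rewrite -coef_map -lead_coefE lead_coef_eq0.
  exists b`_i => // phi ker phib.
  have /closed_nonrootP[z zb] : map_poly phi b != 0.
    by apply: contraNneq phib => /polyP/(_ i); rewrite coef_map coef0 => ->.
  exists z => // p jp; rewrite (_ : map_poly phi p = 0) ?horner0 //.
  apply/polyP => l; rewrite coef_map coef0; apply: ker.
  have [pn0|pn0] := eqVneq (map_poly f p) 0; last by case: noq; exists p.
  by have /polyP/(_ l) := pn0; rewrite coef_map coef0.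
have [q [[jq qn0] lq qmin]] := @minimal_lift _ _ f
  (fun p => p.[x] = 0 /\ p != 0) q1
  (fun p => @proj2 _ _) (conj (etrans (esym (jE _)) jq1) q1n0).
have {}jq : j q = 0 by rewrite jE.
have {}qmin p : j p = 0 -> map_poly f p != 0 -> (size q <= size (map_poly f p))%N.
  by rewrite jE => jp pn0; apply: qmin.
have [s [u [fs jsu]]] := const_multiple lq jq jb qmin.
exists (lead_coef q * s) => [|phi ker]; first by rewrite !rmorphM mulf_neq0.
rewrite rmorphM mulf_eq0 negb_or => /andP[phiq phis].
(* The degree of [q] survives under [phi], and [q] is not constant, since a constant killed by [j]
   would have its leading coefficient killed by [f]. *)
have /closed_rootP[z /rootP zq] : size (map_poly phi q) != 1.
  rewrite size_map_poly_id0 //; apply: contraNneq lq => /eqP/size_poly1P[c _ qc].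
  by rewrite -jq qc lead_coefC.
have kerz p : j p = 0 -> (map_poly phi p).[z] = 0.
  move=> jp; have [N [h [r [e szr]]]] := division p lq.
  have jr : j r = 0.
    have /(congr1 j) := e; rewrite -mul_polyC rmorphD !rmorphM jp jq !mulr0.
    by rewrite add0r.
  have r0 : map_poly f r = 0.
    by apply/eqP/negP => /negP rn0; have := qmin r jr rn0; rewrite leqNgt szr.
  have phir : map_poly phi r = 0.
    apply/polyP => l; rewrite coef_map coef0; apply: ker.
    by have /polyP/(_ l) := r0; rewrite coef_map coef0.
  have /(congr1 (fun p => (map_poly phi p).[z])) := e.
  rewrite -mul_polyC rmorphD !rmorphM /= phir addr0 !hornerM zq mulr0.
  rewrite map_polyC hornerC /= => /eqP; rewrite mulf_eq0 rmorphXn expf_eq0.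
  by rewrite (negPf phiq) andbF => /eqP.
exists z => //; have := kerz _ jsu.
rewrite rmorphB rmorphM /= map_polyC !hornerE => /eqP; rewrite subr_eq0 => /eqP e.
by apply: contraNneq phis => b0; rewrite e b0 mulr0.
Qed.

End ExtendPoint.

(** * Points of V(P) off a hypersurface *)

(** The prime ideal is given as the kernel of a morphism to a field, so that its contraction to
    fewer variables is obtained by composition. *)
Lemma mpoly_prime_point (k : closedFieldType) (n : nat) (L : fieldType)
    (i : {rmorphism {mpoly k[n]} -> L}) (b : {mpoly k[n]}) : i b != 0 ->
  exists2 z : 'I_n -> k, (forall p, i p = 0 -> p.@[z] = 0) & b.@[z] != 0.
Proof.
move=> ib.
(* A point is the same as a morphism to [k] fixing the constants, the form that [extend_point]
   handles. *)
suff [phi [phiC ker phib]] : exists phi : {rmorphism {mpoly k[n]} -> k},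
    [/\ forall c, phi c%:MP = c, forall p, i p = 0 -> phi p = 0 & phi b != 0].
  have phiE p : phi p = p.@[fun l => phi 'X_l].
    rewrite {1}[p]mpolyE rmorph_sum mevalE; apply: eq_bigr => /= m _.
    rewrite -mul_mpolyC rmorphM phiC; congr (_ * _).
    rewrite mpolyXE_id rmorph_prod; apply: eq_bigr => l _; exact: rmorphXn.
  exists (fun l => phi 'X_l) => [p /ker|]; by rewrite -phiE.
elim: n i b ib => [|n IH] i b ib.
  pose phi : {rmorphism {mpoly k[0]} -> k} := meval (fun _ => 0).
  have C (p : {mpoly k[0]}) : p = (p@_0)%:MP.
    apply/mpolyP => m; rewrite mcoeffC (_ : m = 0%MM) ?eqxx ?mulr1 //.
    by apply/mnmP => -[].
  exists phi; split=> [c|p|]; first by rewrite /phi /= mevalC.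
    rewrite [p]C /phi /= mevalC => ip; apply/eqP; move/eqP: ip.
    by rewrite (fmorph_eq0 (i \o @mpolyC 0 k)).
  rewrite [b]C /phi /= mevalC; apply: contraNneq ib => b0.
  by rewrite [b]C b0 mpolyC0 rmorph0.
(* [h] sends the polynomial variable to the last variable; by [hK] it undoes [muni], so [i] factors
   through [muni] as [j]. *)
pose h : {rmorphism {poly {mpoly k[n]}} -> {mpoly k[n.+1]}} :=
  horner_morph (fun a : {mpoly k[n]} => mulrC 'X_ord_max (mwiden a)).
have hC c : h c%:P = mwiden c by rewrite /h /= /horner_morph map_polyC hornerC.
have hX : h 'X = 'X_ord_max by rewrite /h /= /horner_morph map_polyX hornerX.
have hK p : h (muni p) = p.
  rewrite muniE rmorph_sum [RHS]mpolyE; apply: eq_bigr => m _.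
  rewrite -!mul_polyC rmorphM rmorphXn hX hC mwidenZ mwidenX -scalerAl.
  congr (_ *: _); rewrite mpolyXn -mpolyXD; congr 'X_[_].
  apply/mnmP => l; rewrite mnmDE mulmnE mnm1E.
  case: (unliftP ord_max l) => [l' ->|->]; last first.
    by rewrite mnmwiden_ordmax eqxx mul1n.
  have -> : lift ord_max l' = widen_ord (leqnSn n) l' by apply/val_inj/lift_max.
  by rewrite mnmwiden_widen mnmE -val_eqE /= gtn_eqF ?ltn_ord // mul0n addn0.
pose j : {rmorphism {poly {mpoly k[n]}} -> L} := (i \o h)%FUN.
have jmuni p : j (muni p) = i p by rewrite /j /= hK.
have jb : j (muni b) != 0 by rewrite jmuni.
have [a ja ext] := extend_point k jb.
have [phi [phiC ker phia]] := IH (j \o polyC)%FUN a ja.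
have [z kerz zb] := ext phi ker phia.
exists (horner_morph (fun t => mulrC z (phi t)) \o @muni n k)%FUN.
split=> [c|p ip|//]; last by apply: kerz; rewrite jmuni.
by rewrite /= muniC /horner_morph map_polyC hornerC /= phiC.
Qed.

(** * Independence of columns through minors *)

(** Full row rank yields a maximal independent set of columns; conversely, an invertible submatrix
    kills no nonzero row vector. A non-injective [g] repeats a column and gives determinant 0. *)
Lemma row_free_minorP (F : fieldType) (p q : nat) (M : 'M[F]_(p, q)) :
  reflect (exists g : {ffun 'I_p -> 'I_q}, \det (colsub g M) != 0) (row_free M).
Proof.
apply: (iffP idP) => [fM|[g detg]].
  have fT : row_full M^T by rewrite /row_full mxrank_tr.
  exists (fullrankfun fT).
  rewrite -unitfE -unitmxE -unitmx_tr -row_full_unit trmx_mxsub.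
  exact: fullrowsub_full.
apply: inj_row_free => v vM.
have /(congr1 (mulmx^~ (invmx (colsub g M)))) : v *m colsub g M = 0.
  have -> : v *m colsub g M = colsub g (v *m M).
    by apply/matrixP => a b; rewrite !mxE; apply: eq_bigr => l _; rewrite mxE.
  by rewrite vM; apply/matrixP => a b; rewrite !mxE.
by rewrite mulmxK ?mul0mx // unitmxE unitfE.
Qed.

Section ColIndep.
Variables (F : fieldType) (r m : nat).

Lemma col_indepE (B : 'M[F]_(r, m)) (I : {set 'I_m}) :
  col_indep B I = row_free (rowsub (@enum_val _ (mem I)) B^T).
Proof.
set M := rowsub _ _.
have rowM i : (row i M)^T = col (enum_val i) B by apply/matrixP => a b; rewrite !mxE.
have -> : col_indep B I = free [tuple (row i M)^T | i < #|I|].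
  rewrite /col_indep; congr free; apply: (@eq_from_nth _ 0).
    by rewrite size_map [RHS]size_tuple [RHS]cardE.
  move=> i; rewrite size_map -cardE => lti.
  have x0 : 'I_m := enum_val (Ordinal lti).
  rewrite (nth_map x0) -?cardE //.
  by rewrite -[RHS](tnth_nth 0 _ (Ordinal lti)) tnth_mktuple rowM (enum_val_nth x0).
have sumM (v : 'I_#|I| -> F) :
    \sum_i v i *: [tuple (row i M)^T | i < #|I|]`_i = ((\row_i v i) *m M)^T.
  rewrite mulmx_sum_row raddf_sum; apply: eq_bigr => i _.
  by rewrite -tnth_nth tnth_mktuple; apply/matrixP => a b; rewrite !mxE.
apply/freeP/idP => [fM | fM v].
  apply: inj_row_free => v vM; apply/rowP => i; rewrite mxE.
  apply: (fM (fun i => v 0 i)); rewrite sumM.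
  by rewrite (_ : \row_i _ = v) ?vM ?trmx0 //; apply/rowP => l; rewrite mxE.
rewrite sumM => /(congr1 trmx); rewrite trmxK trmx0 => vM i.
have /rowP/(_ i) : \row_i v i = 0.
  by apply: (row_free_inj fM); rewrite vM mul0mx.
by rewrite !mxE.
Qed.

Lemma col_indepZ (B : 'M[F]_(r, m)) (c : F) (I : {set 'I_m}) :
  c != 0 -> col_indep (c *: B) I = col_indep B I.
Proof.
move=> c0; rewrite !col_indepE.
rewrite (_ : rowsub _ (c *: B)^T = c *: rowsub (@enum_val _ (mem I)) B^T).
  by rewrite /row_free mxrank_scale_nz.
by apply/matrixP => a b; rewrite !mxE.
Qed.

(** The minors are taken in [S], before applying [f], so that the same elements decide independence
    under two different morphisms. *)
Lemma col_indep_map_minorP (S : comNzRingType) (f : {rmorphism S -> F})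
    (B : 'M[S]_(r, m)) (I : {set 'I_m}) :
  reflect (exists g : {ffun 'I_#|I| -> 'I_r},
             f (\det (colsub g (rowsub (@enum_val _ (mem I)) B^T))) != 0)
    (col_indep (map_mx f B) I).
Proof.
have detE (g : {ffun 'I_#|I| -> 'I_r}) :
    \det (colsub g (rowsub (@enum_val _ (mem I)) (map_mx f B)^T)) =
    f (\det (colsub g (rowsub (@enum_val _ (mem I)) B^T))).
  by rewrite -det_map_mx !map_mxsub map_trmx.
rewrite col_indepE.
by apply: (iffP (row_free_minorP _)) => -[g gn0]; exists g;
  rewrite -?detE ?detE in gn0 *.
Qed.

End ColIndep.

(** * Fractions of cosets and common denominators *)

Lemma fraction_surj (R : idomainType) (a : {fraction R}) :
  exists n d : R, d != 0 /\ a = FracField.tofrac n / FracField.tofrac d.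
Proof.
elim/quotW: a => x; exists (frac x).1, (frac x).2.
have x2 := denom_ratioP x; split=> //.
apply: (canRL (mulfK _)); first by rewrite tofrac_eq0.
unlock FracField.tofrac; rewrite -[LHS]FracField.pi_mul.
apply/eqmodP; rewrite /= FracField.equivfE /FracField.mulf.
by rewrite !numden_Ratio ?mulr1 ?mulf_neq0 ?oner_neq0 // mulrC.
Qed.

Lemma coset_frac_surj (k : closedFieldType) (n : nat)
    (P : prime_idealr {mpoly k[n]}) (a : residue_field P) :
  exists f g : {mpoly k[n]}, g \notin P /\ a = coset_frac P f g.
Proof.
have coset_surj (x : domain_quot P) : exists f, x = coset_mod P f.
  by exists (repr (x : {ideal_quot P})); rewrite /coset_mod reprK.
have [x [y [y0 ->]]] := fraction_surj a.
have [[f ->] [g gE]] := (coset_surj x, coset_surj y).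
by exists f, g; split; [rewrite -coset_mod_eq0 -gE | rewrite /coset_frac -gE].
Qed.

Lemma common_denominator (k : closedFieldType) (n : nat)
    (P : prime_idealr {mpoly k[n]}) (r m : nat) (A : 'M[residue_field P]_(r, m)) :
  exists (d : {mpoly k[n]}) (B : 'M[{mpoly k[n]}]_(r, m)),
    d \notin P /\ forall i j, A i j = coset_frac P (B i j) d.
Proof.
have nz h : (FracField.tofrac (coset_mod P h) == 0) = (h \in P).
  by rewrite tofrac_eq0 coset_mod_eq0.
have [F FP] := choice (fun ij => coset_frac_surj (A ij.1 ij.2)).
have [G GP] := choice FP.
(* The factor that brings the entry at [ij] to the common denominator, the product of all [G l]. *)
pose c ij := \prod_(l | l != ij) G l.
have cP ij : c ij \notin P.
  rewrite -nz !rmorph_prod; apply/prodf_neq0 => l _.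
  by rewrite nz; case: (GP l).
have dE ij : \prod_l G l = G ij * c ij by rewrite (bigD1 ij).
exists (\prod_l G l), (\matrix_(i, j) (F (i, j) * c (i, j))); split.
  rewrite -nz !rmorph_prod; apply/prodf_neq0 => l _.
  by rewrite nz; case: (GP l).
move=> i j; have [_ /= ->] := GP (i, j).
rewrite (dE (i, j)) mxE /coset_frac !rmorphM -mulf_div divff ?mulr1 //.
by rewrite nz.
Qed.

Theorem theorem2p4 (k : closedFieldType) (k_char0 : [pchar k] =i pred0)
    (n : nat) (P : prime_idealr {mpoly k[n]})
    (r m : nat) (A : 'M[residue_field P]_(r, m)) :
  exists U : set ('I_n -> k),
    [/\ (U !=set0)%classic, (U `<=` zero_locus P)%classic
      & forall u, U u ->
          specialization_defined A u /\
          linear_matroid A = linear_matroid (specialization A u)].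
Proof.
pose iota : {rmorphism {mpoly k[n]} -> residue_field P} :=
  (@FracField.tofrac (domain_quot P) \o coset_mod P)%FUN.
have iota0 p : (iota p == 0) = (p \in P) by rewrite /= tofrac_eq0 coset_mod_eq0.
have [d [B [dP AE]]] := common_denominator A.
pose minor (I : {set 'I_m}) (g : {ffun 'I_#|I| -> 'I_r}) :=
  \det (colsub g (rowsub (@enum_val _ (mem I)) B^T)).
pose b := d * \prod_I \prod_(g | iota (@minor I g) != 0) @minor I g.
have ib : iota b != 0.
  rewrite rmorphM mulf_neq0 //; first by rewrite iota0.
  rewrite rmorph_prod; apply/prodf_neq0 => I _.
  by rewrite rmorph_prod; apply/prodf_neq0.
have [z kerz zb] := mpoly_prime_point ib.
have Vz : zero_locus P z by move=> p pP; apply: kerz; apply/eqP; rewrite iota0.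
move: zb; rewrite mevalM mulf_eq0 negb_or => /andP[zd].
rewrite rmorph_prod => /prodf_neq0 zminor.
exists [set z]%classic; split=> [|_ -> //|_ ->]; first by exists z.
have def : specialization_defined A z.
  by move=> i j; exists (B i j), d; rewrite AE.
split=> //; apply: val_inj; apply/setP => I; rewrite !inE.
(* Both matrices are nonzero scalar multiples of images of [B], and scaling does not affect
   independence. *)
have -> : specialization A z = d.@[z]^-1 *: map_mx (meval z) B.
  apply/matrixP => i j; rewrite !mxE mulrC; apply: specialize_eltE => //.
  by exists (B i j), d; rewrite AE.
have -> : A = (iota d)^-1 *: map_mx iota B.
  by apply/matrixP => i j; rewrite !mxE AE mulrC.
rewrite !col_indepZ ?invr_eq0 ?iota0 //.
apply/col_indep_map_minorP/col_indep_map_minorP => -[g gn0]; exists g.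
  (* A minor nonzero in k(P) is a factor of [b], hence nonzero at [z]; in the other direction, a
     minor in [P] vanishes at [z]. *)
  have := zminor I isT; rewrite rmorph_prod => /prodf_neq0; exact.
by apply: contra_neq gn0 => /kerz.
Qed.
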